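(* $P_h([0,1])=\{1,2,3,\ldots\}\cup\{+\infty\}$.
   Context: For a topological space $A$, $Homeo(A)$ denotes the group of all homeomorphisms $A\to A$ under composition. For a subgroup $G$ of $Homeo(A)$ (acting by $gx=g(x)$), a nonempty subset $Y\subseteq A$ is invariant if $g(y)\in Y$ for all $g\in G$, $y\in Y$. The height of $(G,A)$ is $h(G,A)=\sup\{n\geq 0:$ there exist distinct closed invariant subsets $Y_0\subset Y_1\subset\cdots\subset Y_n=A\}$ (possibly $+\infty$). Finally $P_h(A)=\{h(G,A): G \text{ is a subgroup of } Homeo(A)\}$. *)

(* Defs.v *)
From HB Require Import structures.
From mathcomp Require Import all_boot all_order all_algebra.
From mathcomp Require Import all_classical all_reals all_analysis.
Set Implicit Arguments. Unset Strict Implicit. Unset Printing Implicit Defensive.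
Import Order.TTheory GRing.Theory Num.Theory.
Import numFieldNormedType.Exports.
Local Open Scope classical_set_scope.
Local Open Scope ring_scope.

Definition is_homeo (A : topologicalType) (f : A -> A) : Prop :=
  continuous f /\ exists g : A -> A, [/\ continuous g, g \o f = id & f \o g = id].

Definition homeo_subgroup (A : topologicalType) (G : set (A -> A)) : Prop :=
  [/\ G `<=` [set f | is_homeo f],
      G id,
      (forall f g, G f -> G g -> G (f \o g)) &
      (forall f, G f -> exists2 g, G g & g \o f = id /\ f \o g = id)].

Definition invariant (A : topologicalType) (G : set (A -> A)) (Y : set A) : Prop :=
  Y !=set0 /\ (forall g y, G g -> Y y -> Y (g y)).

Definition has_chain (A : topologicalType) (G : set (A -> A)) (n : nat) : Prop :=
  exists Y : nat -> set A,
    [/\ (forall i, (i <= n)%N -> closed (Y i) /\ invariant G (Y i)),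
        (forall i, (i < n)%N -> Y i `<=` Y i.+1 /\ Y i != Y i.+1) &
        Y n = setT].

Definition height (R : realType) (A : topologicalType) (G : set (A -> A)) : \bar R :=
  ereal_sup [set (n%:R)%:E | n in [set n : nat | has_chain G n]].

Definition P_h (R : realType) (A : topologicalType) : set (\bar R) :=
  [set height R G | G in [set G : set (A -> A) | homeo_subgroup G]].
Arguments height R {A} G.
Arguments P_h R A : clear implicits.

(* Main.v *)
(* A homeomorphism of [0,1] is monotone, so it preserves the closed set {0,1};
   hence every height is at least 1.  The trivial group has infinite height.
   For n >= 1, fold [0,1] onto [0, n/2] by u(x) = n min(x, 1 - x) and let G
   consist of the homeomorphisms f such that u(f x) and u(x) always have the same
   floor and the same ceiling.  The reflection and piecewise-linear pushes inside
   the intervals ]j/n, (j+1)/n[ show that G acts transitively on each of the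
   n./2 + 1 sets {u = j} and each of the uphalf n sets {j < u < j + 1}.  These are
   n + 1 orbits; adding them one at a time, the sets {u = j} first, gives closed
   sets, so the height of G is exactly n. *)
Require Import Defs.
From HB Require Import structures.
From mathcomp Require Import all_boot all_order all_algebra.
From mathcomp Require Import ring lra zify.
From mathcomp Require Import all_classical all_reals all_analysis.
Import Order.TTheory GRing.Theory Num.Theory.
Import numFieldNormedType.Exports.
Local Open Scope classical_set_scope.
Local Open Scope ring_scope.

Set Implicit Arguments.
Unset Strict Implicit.

(** * Orbits of a homeomorphism group and chains of invariant sets *)

Section Orbits.
Variable A : topologicalType.
Implicit Type G : set (A -> A).

(** The colouring [c] is an orbit invariant; finite heights are realised by choosing [c] so that its
    fibres are exactly the orbits. *)
Definition stab (T : Type) (c : A -> T) : set (A -> A) :=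
  [set f | is_homeo f /\ forall x, c (f x) = c x].

Lemma continuous_idfun : continuous (fun x : A => x).
Proof. by move=> x; exact: cvg_id. Qed.

Lemma is_homeo_id : is_homeo (@idfun A).
Proof. by split; last exists idfun; do ?split; exact: continuous_idfun. Qed.

Lemma is_homeo_comp (f g : A -> A) : is_homeo f -> is_homeo g -> is_homeo (f \o g).
Proof.
move=> [cf [f' [cf' ff' f'f]]] [cg [g' [cg' gg' g'g]]]; split.
  by move=> x; apply: continuous_comp; [exact: cg | exact: cf].
exists (g' \o f'); split.
- by move=> x; apply: continuous_comp; [exact: cf' | exact: cg'].
- by rewrite -compA (compA f') ff'.
- by rewrite -compA (compA g) g'g.
Qed.

Lemma homeo_subgroup_stab (T : Type) (c : A -> T) : homeo_subgroup (stab c).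
Proof.
split.
- by move=> f [].
- by split=> //; exact: is_homeo_id.
- move=> f g [hf cf] [hg cg]; split=> [|x /=].
    exact: is_homeo_comp.
  by rewrite cf cg.
- move=> f [[cf [g [cg gf fg]]] cE]; exists g => //; split.
    by split=> //; exists f.
  by move=> x; rewrite -[in RHS](congr1 (fun h => h x) fg) /= cE.
Qed.

Lemma homeo_subgroup1 : homeo_subgroup [set @idfun A].
Proof.
split.
- by move=> f ->; exact: is_homeo_id.
- by [].
- by move=> f g -> ->.
- by move=> f ->; exists idfun.
Qed.

(** Every strict inclusion in a chain brings in a point of a new orbit, and the points [p k] meet
    every orbit, so a chain has at most [n + 1] sets. *)
Lemma chain_le G n (p : 'I_n.+1 -> A) m : homeo_subgroup G ->
  (forall x, exists k, exists2 g, G g & g (p k) = x) ->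
  has_chain G m -> (m <= n)%N.
Proof.
move=> [_ _ _ Ginv] /choice[kappa kappaP] [Y [Ycl Ylt _]].
have Yle i j : (i <= j)%N -> (j <= m)%N -> Y i `<=` Y j.
  elim: j => [|j IH]; first by rewrite leqn0 => /eqP-> _ x.
  rewrite leq_eqVlt => /orP[/eqP-> _ x //|ij jm].
  exact: subset_trans (IH ij (ltnW jm)) (proj1 (Ylt _ jm)).
(* Equal representatives mean equal orbits: [y] is reached from [x] through [p (kappa x)]. *)
have Ysat j x y : (j <= m)%N -> kappa x = kappa y -> Y j x -> Y j y.
  move=> jm xy Yx; have [_ [_ Yinv]] := Ycl j jm.
  have [g Gg gx] := kappaP x; have [h Gh hy] := kappaP y.
  have [g' Gg' [g'g _]] := Ginv g Gg.
  have -> : y = h (g' x); last by apply: (Yinv _ _ Gh); exact: (Yinv _ _ Gg').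
  by rewrite -hy -xy -[in RHS]gx -[p _ in LHS](congr1 (@^~ (p (kappa x))) g'g).
(* [z i] is a point of [Y i] in no earlier set; for [i = 0] it comes from the nonemptiness built
   into [invariant]. *)
have /choice[z zP] (i : 'I_m.+1) :
    exists z, Y i z /\ forall j, (j < i)%N -> ~ Y j z.
  case: i => -[|i] im /=.
    by have [_ [[z Yz] _]] := Ycl 0%N isT; exists z.
  have [sY neY] := Ylt i im.
  have /existsNP[z /not_implyP[Yz nYz]] : ~ (Y i.+1 `<=` Y i).
    by move=> sY'; move/eqP: neY; apply; apply/seteqP.
  exists z; split=> // j ji Yjz; apply: nYz.
  exact: (Yle j i _ (ltnW im)).
have inj : injective (kappa \o z).
  move=> i j /= ij; apply/val_inj => /=.
  have [lt_ij|lt_ji|//] := ltngtP i j.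
    case: (proj2 (zP j) i lt_ij); apply: Ysat ij (proj1 (zP i)).
    by rewrite -ltnS.
  case: (proj2 (zP i) j lt_ji); apply: Ysat (esym ij) (proj1 (zP j)).
  by rewrite -ltnS.
by have := leq_card _ inj; rewrite !card_ord.
Qed.

End Orbits.

(** * The height as a supremum of chain lengths *)

Section Height.
Variables (R : realType) (A : topologicalType) (G : set (A -> A)).

Lemma height_max n : has_chain G n -> (forall m, has_chain G m -> (m <= n)%N) ->
  height R G = (n%:R)%:E.
Proof.
move=> Gn Gle; apply/eqP; rewrite eq_le; apply/andP; split.
  by apply: ge_ereal_sup => _ [m /Gle mn <-]; rewrite lee_fin ler_nat.
by apply: ereal_sup_ubound; exists n.
Qed.

Lemma height_unbounded : (forall n, exists2 m, has_chain G m & (n <= m)%N) ->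
  height R G = +oo%E.
Proof.
move=> Gn; apply/eqyP => r r0.
have [m Gm rm] := Gn (Num.trunc r).+1.
apply: (@le_trans _ _ (m%:R%:E)); last by apply: ereal_sup_ubound; exists m.
rewrite lee_fin; apply: (@le_trans _ _ (Num.trunc r).+1%:R); last by rewrite ler_nat.
by have /andP[_ /ltW] := truncn_itv (ltW r0).
Qed.

(** Bounded chain lengths have a maximum, which is then the height; unbounded ones give infinite
    height. *)
Lemma height_values n : has_chain G n ->
  (exists2 m, (n <= m)%N & (m%:R)%:E = height R G) \/ height R G = +oo%E.
Proof.
move=> Gn.
have [[N GN]|unb] := pselect (exists N, forall m, has_chain G m -> (m <= N)%N).
  have ex : exists m, `[< has_chain G m >] by exists n; exact/asboolP.
  have ub m : `[< has_chain G m >] -> (m <= N)%N by move/asboolP/GN.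
  case: (ex_maxnP ex ub) => k /asboolP Gk kmax.
  have kle m : has_chain G m -> (m <= k)%N by move/asboolP/kmax.
  by left; exists k; [exact: kle | rewrite (height_max Gk)].
right; apply: height_unbounded => N; apply: contrapT => H.
apply: unb; exists N => m Gm; rewrite leqNgt; apply/negP => Nm; apply: H.
by exists m => //; exact: ltnW.
Qed.

End Height.

(** * Increasing bijections of the line supported in an interval *)

Section Push.
Variable R : realType.
Implicit Types f g : R -> R.

(* For real functions this says that [f] and [g] are mutually inverse increasing
   bijections, in a form that is stable under [max] and [min]. *)
Definition adjoint2 f g :=
  forall t s, ((f t <= s) = (t <= g s)) * ((s <= f t) = (g s <= t)).

Lemma adjoint2_cancel f g : adjoint2 f g -> cancel f g /\ cancel g f.
Proof.
move=> fg; split=> t; apply/eqP; rewrite eq_le.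
  by rewrite -(fg t (f t)).1 -(fg t (f t)).2 lexx.
by rewrite (fg (g t) t).1 (fg (g t) t).2 lexx.
Qed.

(** A maximum is at most [s] when both terms are, and a minimum is at least [t] when both terms are;
    hence inversion exchanges [max] and [min]. *)
Lemma adjoint2_max f1 g1 f2 g2 : adjoint2 f1 g1 -> adjoint2 f2 g2 ->
  adjoint2 (fun t => Num.max (f1 t) (f2 t)) (fun s => Num.min (g1 s) (g2 s)).
Proof.
move=> h1 h2 t s; split; first by rewrite ge_max le_min (h1 t s).1 (h2 t s).1.
by rewrite le_max ge_min (h1 t s).2 (h2 t s).2.
Qed.

Lemma adjoint2_min f1 g1 f2 g2 : adjoint2 f1 g1 -> adjoint2 f2 g2 ->
  adjoint2 (fun t => Num.min (f1 t) (f2 t)) (fun s => Num.max (g1 s) (g2 s)).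
Proof.
move=> h1 h2 t s; split; first by rewrite ge_min le_max (h1 t s).1 (h2 t s).1.
by rewrite le_min ge_max (h1 t s).2 (h2 t s).2.
Qed.

Lemma adjoint2_affine (c k : R) : 0 < k ->
  adjoint2 (fun t => c + k * (t - c)) (fun s => c + k^-1 * (s - c)).
Proof.
move=> k0 t s; split.
  by rewrite -[LHS]lerBrDl -[RHS]lerBlDl ler_pdivlMl.
by rewrite -[LHS]lerBlDl -[RHS]lerBrDl ler_pdivrMl.
Qed.

Lemma adjoint2_id : adjoint2 id id. Proof. by []. Qed.

Lemma continuous_affine (c k : R) : continuous (fun t : R => c + k * (t - c)).
Proof.
move=> t; apply: cvgD; first exact: cvg_cst.
apply: cvgM; first exact: cvg_cst.
by apply: cvgB; [exact: cvg_id | exact: cvg_cst].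
Qed.

Lemma continuous_maxf f g : continuous f -> continuous g ->
  continuous (fun t => Num.max (f t) (g t)).
Proof. by move=> cf cg t; apply: continuous_max; [exact: cf | exact: cg]. Qed.

Lemma continuous_minf f g : continuous f -> continuous g ->
  continuous (fun t => Num.min (f t) (g t)).
Proof. by move=> cf cg t; apply: continuous_min; [exact: cf | exact: cg]. Qed.

(** Since the push maps []a, b[] to itself and fixes all other points, it preserves any colouring
    that is constant on that interval. *)
Lemma increasing_push (a b x y : R) : a < x < b -> a < y < b ->
  exists f g, [/\ continuous f, continuous g, cancel f g, cancel g f &
    f x = y /\ forall t, f t = t \/ (a < t < b /\ a < f t < b)].
Proof.
(* Exchanging [f] with its inverse exchanges [x] and [y]. *)
wlog xy : x y / x <= y.
  move=> W xab yab; have [/W|/ltW yx] := leP x y; first exact.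
  have [f [g [cf cg fg gf [fx ft]]]] := W _ _ yx yab xab.
  exists g, f; split; [by []|by []|by []|by []|split].
    by rewrite -fx fg.
  move=> t; have := ft (g t); rewrite gf => -[<-|[gt tab]]; last by right.
  by left.
move=> /andP[ax xb] /andP[ay yb].
(* Slopes of the segments from [(a, a)] to [(x, y)] and from [(x, y)] to [(b, b)]; [x <= y] puts 1
   between them. *)
pose k1 := (y - a) / (x - a); pose k2 := (b - y) / (b - x).
have xa0 : 0 < x - a by lra.
have bx0 : 0 < b - x by lra.
have k1_ge1 : 1 <= k1 by rewrite /k1 ler_pdivlMr //; lra.
have k2_le1 : k2 <= 1 by rewrite /k2 ler_pdivrMr //; lra.
have k2_gt0 : 0 < k2 by rewrite /k2 divr_gt0 //; lra.
have k1_gt0 : 0 < k1 by lra.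
pose L1 t := a + k1 * (t - a); pose L2 t := b + k2 * (t - b).
(* On [a, b] this is the concave broken line through (a, a), (x, y), (b, b). *)
pose f t := Num.max t (Num.min (L1 t) (L2 t)).
have [fg gf] := adjoint2_cancel (adjoint2_max adjoint2_id
  (adjoint2_min (adjoint2_affine a k1_gt0) (adjoint2_affine b k2_gt0))).
exists f; eexists; split; [| |exact: fg|exact: gf|split].
- apply: continuous_maxf; first exact: continuous_idfun.
  by apply: continuous_minf; exact: continuous_affine.
- apply: continuous_minf; first exact: continuous_idfun.
  by apply: continuous_maxf; exact: continuous_affine.
- have -> : f x = Num.max x (Num.min y y).
    congr (Num.max x (Num.min _ _)); rewrite /L1 /L2 /k1 /k2.
      by rewrite divfK ?gt_eqF //; lra.
    by rewrite -[x - b]opprB mulrN divfK ?gt_eqF //; lra.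
  by rewrite minxx; exact: max_r.
(* Left of [a] the line [L1], and right of [b] the line [L2], lies below the diagonal, so the
   maximum returns [t]. *)
- move=> t; have [ta|at_] := leP t a.
    left; apply: max_l; rewrite ge_min; apply/orP; left; rewrite /L1; nra.
  have [bt|tb] := leP b t.
    left; apply: max_l; rewrite ge_min; apply/orP; right; rewrite /L2; nra.
  right; split=> //; rewrite /f lt_max gt_max gt_min at_ tb /=.
  by apply/orP; right; rewrite /L2; nra.
Qed.

End Push.

(** * Homeomorphisms of the unit interval *)

Section Segment.
Variable R : realType.
Local Notation I := (set_type (`[0, 1]%classic : set R)).

Lemma continuous_valI : continuous (fun x : I => val x).
Proof. exact: initial_continuous. Qed.

Lemma segment_bounds (x : I) : 0 <= val x <= 1.
Proof. by have := set_valP x; rewrite /= in_itv. Qed.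

Definition segment_point (t : R) (t01 : 0 <= t <= 1) : I :=
  exist _ t (mem_set (t01 : `[0, 1]%classic t)).

Definition segment_map (f : R -> R)
    (f01 : forall t, 0 <= t <= 1 -> 0 <= f t <= 1) (x : I) : I :=
  segment_point (f01 _ (segment_bounds x)).

Lemma continuous_segment_map (f : R -> R) f01 :
  continuous f -> continuous (@segment_map f f01).
Proof.
move=> cf; apply: continuous_comp_initial => x.
exact: (continuous_comp (@continuous_valI x) (cf _)).
Qed.

Lemma homeo_segment_map (f g : R -> R) f01 :
  continuous f -> continuous g -> cancel f g -> cancel g f ->
  (forall t, 0 <= t <= 1 -> 0 <= g t <= 1) -> is_homeo (@segment_map f f01).
Proof.
move=> cf cg fg gf g01; split; first exact: continuous_segment_map.
exists (segment_map g01); split; first exact: continuous_segment_map.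
  by apply/funext => x; apply/val_inj; exact: fg.
by apply/funext => x; apply/val_inj; exact: gf.
Qed.

Lemma bounds0 : 0 <= (0 : R) <= 1. Proof. by lra. Qed.

Lemma bounds1 : 0 <= (1 : R) <= 1. Proof. by lra. Qed.

(** A continuous injection of an interval is monotone. Comparing an endpoint with the preimages of 0
    and 1 squeezes its image against a bound of the interval. *)
Lemma homeo_endpoints (h : I -> I) : is_homeo h -> forall x : I,
  val x = 0 \/ val x = 1 -> val (h x) = 0 \/ val (h x) = 1.
Proof.
move=> [ch [g [_ gh hg]]] x x01.
have hK y : h (g y) = y by exact: (congr1 (@^~ y) hg).
have gK y : g (h y) = y by exact: (congr1 (@^~ y) gh).
(* Extension of [h] to the whole line by the default value 0; only its values on the interval
   matter. *)
pose f := valL_ 0 (fun y : I => val (h y)).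
have fsig : sigL `[0, 1] f = (fun y : I => val (h y)).
  exact: (congr1 (@^~ (fun y : I => val (h y))) (sigL_valL (0 : R))).
have fE y : f (val y) = val (h y) by exact: (congr1 (@^~ y) fsig).
have cf : {within [set` `[0, 1]], continuous f}.
  apply/subspace_sigL_continuousP; rewrite fsig => y.
  exact: (continuous_comp (ch y) (@continuous_valI (h y))).
have mf : unstable.monotonic `[0, 1] f.
  apply: unstable.strict_monotonicW; apply: itv_continuous_inj_mono => // s t s01 t01.
  move=> ff; pose y := segment_point s01; pose z := segment_point t01.
  have /val_inj/(congr1 g) : val (h y) = val (h z) by rewrite -!fE.
  by rewrite !gK => /(congr1 val).
pose o0 : I := segment_point bounds0; pose o1 : I := segment_point bounds1.
have mem (y : I) : val y \in `[0, 1] by rewrite in_itv; exact: segment_bounds.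
have f0 : f (val (g o0)) = 0 by rewrite fE hK.
have f1 : f (val (g o1)) = 1 by rewrite fE hK.
have /andP[l1 u1] := segment_bounds (g o1).
have /andP[l0 u0] := segment_bounds (g o0).
have /andP[lh uh] := segment_bounds (h x).
rewrite -fE in lh uh *.
have [[i0 i1] ix] := (mem (g o0), mem (g o1), mem x).
case: mf => mf; case: x01 => x01; rewrite x01 in lh uh ix *.
- have := mf _ _ ix i0 l0; rewrite f0 => fx.
  by left; apply/eqP; rewrite eq_le fx.
- have := mf _ _ i1 ix u1; rewrite f1 => fx.
  by right; apply/eqP; rewrite eq_le uh.
- have := mf _ _ i1 ix l1; rewrite f1 => fx.
  by right; apply/eqP; rewrite eq_le uh.
- have := mf _ _ ix i0 u0; rewrite f0 => fx.
  by left; apply/eqP; rewrite eq_le fx.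
Qed.

Lemma closed_segment (B : set R) (u : R -> R) : continuous u -> closed B ->
  closed [set x : I | B (u (val x))].
Proof.
move=> cu clB; apply: (@preimage_closed I R (fun x : I => u (val x)) B) => // x _.
exact: (continuous_comp (@continuous_valI x) (cu _)).
Qed.

Lemma closed_set1R (a : R) : closed [set a].
Proof. exact/accessible_closed_set1/hausdorff_accessible/Rhausdorff. Qed.

Lemma has_chain1 (G : set (I -> I)) : homeo_subgroup G -> has_chain G 1.
Proof.
move=> [Gh _ _ _].
have bh : 0 <= (2^-1 : R) <= 1 by lra.
pose Y i : set I := if i is 0%N then [set x | val x = 0 \/ val x = 1] else setT.
exists Y; split=> // [[|i] _|[|i] //= _] /=.
- split; last first.
    split; first by exists (segment_point bounds0); left.
    by move=> g y /Gh hg; exact: (homeo_endpoints hg).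
  exact: (closed_segment (@continuous_idfun R)
    (closedU (@closed_set1R 0) (@closed_set1R 1))).
- split; first exact: closedT.
  by split=> //; exists (segment_point bounds0).
- split=> //; apply/eqP => /seteqP[_ /(_ (segment_point bh) Logic.I)] /= [|]; lra.
Qed.

(** Every nonempty set is invariant under the trivial group, so initial segments with equally spaced
    ends, starting from the point 0, form a chain. *)
Lemma has_chain_id n : has_chain [set @idfun I] n.+1.
Proof.
have b i : (i <= n.+1)%N -> 0 <= (i%:R / n.+1%:R : R) <= 1.
  by move=> le_in; rewrite divr_ge0 // ler_pdivrMr // mul1r ler_nat.
exists (fun i => [set x : I | val x <= i%:R / n.+1%:R]); split.
- move=> i le_in; split.
    exact: (closed_segment (@continuous_idfun R) (@closed_le _ (i%:R / n.+1%:R))).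
  by split=> [|_ y ->//]; exists (segment_point (b 0%N isT));
    rewrite /= mul0r; case/andP: (b i le_in).
- move=> i lt_in; have lt_i : i%:R / n.+1%:R < i.+1%:R / n.+1%:R :> R.
    by rewrite ltr_pM2r ?invr_gt0 // ltr_nat.
  split; first by move=> x /= /le_trans; apply; exact: ltW.
  apply/eqP => /seteqP[_ /(_ (segment_point (b _ lt_in)))] /=.
  by move/(_ (lexx _)); rewrite leNgt lt_i.
- apply/seteqP; split=> // x _ /=; rewrite divff ?pnatr_eq0 //.
  by case/andP: (segment_bounds x).
Qed.

End Segment.

(** * Folding the interval: groups of every positive finite height *)

Section Levels.
Variables (R : realType) (n : nat).
Hypothesis n_gt0 : (0 < n)%N.
Local Notation I := (set_type (`[0, 1]%classic : set R)).

(** Floor and ceiling agree exactly at the integers, so together they separate each integer from the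
    adjacent open unit intervals. *)
Definition cell (t : R) : int * int := (Num.floor t, Num.ceil t).

Lemma cell_le (s t : R) (j : nat) : cell s = cell t -> (s <= j%:R) = (t <= j%:R).
Proof. by move=> [_ st]; rewrite -[j%:R]/(j%:~R) -!ceil_le_int st. Qed.

Lemma cell_ge (s t : R) (j : nat) : cell s = cell t -> (j%:R <= s) = (j%:R <= t).
Proof. by move=> [st _]; rewrite -[j%:R]/(j%:~R) -!floor_ge_int st. Qed.

Lemma cell_eq (s t : R) (j : nat) : cell s = cell t -> (s == j%:R) = (t == j%:R).
Proof. by move=> st; rewrite !eq_le (cell_le j st) (cell_ge j st). Qed.

Lemma cell_open (j : nat) (t : R) : j%:R < t < j.+1%:R -> cell t = (j%:Z, j.+1%:Z).
Proof.
move=> /andP[jt tj]; congr pair.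
  by apply: floor_def; rewrite (ltW jt) addrC -intS.
apply: ceil_def; have -> : j.+1%:Z - 1 = j%:Z by lia.
by rewrite jt ltW.
Qed.

Definition fold (t : R) : R := n%:R * Num.min t (1 - t).

Lemma continuous_fold : continuous fold.
Proof.
move=> t; apply: cvgM; first exact: cvg_cst.
apply: (@continuous_minf _ id (fun t => 1 - t)); first exact: continuous_idfun.
by move=> x; apply: cvgB; [exact: cvg_cst | exact: cvg_id].
Qed.

Lemma fold_reflect t : fold (1 - t) = fold t.
Proof. by rewrite /fold minC opprB addrC subrK. Qed.

Lemma fold_half t : t <= 2^-1 -> fold t = n%:R * t.
Proof. by move=> t2; rewrite /fold; congr (_ * _); apply: min_l; lra. Qed.

Definition levelG : set (I -> I) := stab (fun x : I => cell (fold (val x))).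


Lemma levelG_group : homeo_subgroup levelG.
Proof. exact: homeo_subgroup_stab. Qed.

Lemma levelG_reflect : exists2 r, levelG r & forall x : I, val (r x) = 1 - val x.
Proof.
have r01 (t : R) : 0 <= t <= 1 -> 0 <= 1 - t <= 1 by lra.
have cr : continuous (fun t : R => 1 - t).
  by move=> t; apply: cvgB; [exact: cvg_cst | exact: cvg_id].
have rK : cancel (fun t : R => 1 - t) (fun t : R => 1 - t).
  by move=> t; rewrite opprB addrC subrK.
exists (segment_map r01) => //; split.
  exact: (homeo_segment_map r01 cr cr rK rK r01).
by move=> x; rewrite /= fold_reflect.
Qed.

Lemma n0R : 0 < n%:R :> R. Proof. by rewrite ltr0n. Qed.

(** On the left half [fold] is multiplication by [n]: points of equal cell coincide if the value is
    an integer, and otherwise share an interval []j/n, (j+1)/n[] on which a push is available. *)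
Lemma levelG_half (x y : I) : val x <= 2^-1 -> val y <= 2^-1 ->
  cell (fold (val x)) = cell (fold (val y)) -> exists2 g, levelG g & g x = y.
Proof.
move=> x2 y2; rewrite !fold_half // => xy.
have [[_ Gid _ _] n0] := (levelG_group, n0R).
have /andP[x0 x1] := segment_bounds x; have /andP[y0 y1] := segment_bounds y.
have nx0 : 0 <= n%:R * val x by rewrite mulr_ge0 // ltW.
have /andP[] := truncn_itv nx0.
set j := Num.trunc _; rewrite le_eqVlt => /orP[/eqP jx|jx] xj.
  exists idfun => //; apply/val_inj/(mulfI (lt0r_neq0 n0)); apply/esym/eqP.
  by rewrite -jx -(cell_eq j xy) jx.
have jy : j%:R < n%:R * val y by rewrite ltNge -(cell_le j xy) -ltNge.
have yj : n%:R * val y < j.+1%:R by rewrite ltNge -(cell_ge _ xy) -ltNge.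
(* [j < n/2] gives [2j + 1 <= n] by integrality. This keeps [fold] above [j] even when the interval
   contains 1/2, as the middle one does for odd [n]. *)
have j2 : j.+1%:R <= n%:R - j%:R :> R.
  rewrite lerBrDr -natrD ler_nat addSn -(ltr_nat R) natrD.
  by nra.
pose a : R := j%:R / n%:R; pose b : R := j.+1%:R / n%:R.
have itvE (t : R) : (a < t < b) = (j%:R < n%:R * t < j.+1%:R).
  by rewrite ltr_pdivrMr // ltr_pdivlMr // ![t * _]mulrC.
have abx : a < val x < b by rewrite itvE jx.
have aby : a < val y < b by rewrite itvE jy.
have [f [g [cf cg fg gf [fx fP]]]] := increasing_push abx aby.
have gP t : g t = t \/ a < t < b /\ a < g t < b.
  by have := fP (g t); rewrite gf => -[<-|[? ?]]; [left|right].
have ab_cell t : a < t < b -> cell (fold t) = (j%:Z, j.+1%:Z).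
  rewrite itvE => /andP[jt tj]; apply: cell_open; rewrite /fold minr_pMr ?(ltW n0) //.
  rewrite lt_min gt_min jt tj /= andbT mulrBr mulr1; lra.
have ab01 t : a < t < b -> 0 <= t <= 1.
  have a0 : 0 <= a by rewrite divr_ge0 // ltW.
  have b1 : b <= 1 by rewrite ler_pdivrMr // mul1r; have : 0 <= j%:R :> R by []; lra.
  by lra.
have f01 t : 0 <= t <= 1 -> 0 <= f t <= 1 by case: (fP t) => [->//|[_ /ab01]].
have g01 t : 0 <= t <= 1 -> 0 <= g t <= 1 by case: (gP t) => [->//|[_ /ab01]].
exists (segment_map f01); last exact/val_inj.
split; first exact: (homeo_segment_map f01 cf cg fg gf g01).
by move=> z /=; case: (fP (val z)) => [->//|[/ab_cell-> /ab_cell->]].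
Qed.

(** The reflection preserves [fold], so both points can first be moved to the left half. *)
Lemma levelG_transitive (x y : I) :
  cell (fold (val x)) = cell (fold (val y)) -> exists2 g, levelG g & g x = y.
Proof.
have [_ _ Gcomp Ginv] := levelG_group.
have toleft z : exists2 g, levelG g & val (g z) <= 2^-1.
  have [r Gr rE] := levelG_reflect.
  have [z2|z2] := leP (val z) 2^-1; last by exists r => //; rewrite rE; lra.
  by have [_ Gid _ _] := levelG_group; exists idfun.
have [f Gf fx] := toleft x; have [g Gg gy] := toleft y => xy.
have [|h Gh hE] := levelG_half fx gy; first by rewrite (proj2 Gf) (proj2 Gg).
have [g' Gg' [g'g _]] := Ginv g Gg.
exists (g' \o (h \o f)); first exact: Gcomp (Gcomp _ _ Gh Gf).
by rewrite /= hE; exact: (congr1 (@^~ y) g'g).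
Qed.

(* The first [n./2 + 1] representatives are the points, the others the midpoints
   of the intervals; [sublevel k] is the union of the cells of [rep 0, ..., rep k]
   in [0, n/2], since [k - n./2] truncates to 0 for small [k]. *)
Definition rep (k : nat) : R := if (k <= n./2)%N then k%:R else (k - n./2)%:R - 2^-1.

Lemma rep_bounds k : (k <= n)%N -> 0 <= rep k <= n%:R / 2.
Proof.
move=> kn; rewrite /rep ler_pdivlMr //; case: leqP => k2.
  by rewrite ler0n /= -natrM ler_nat; lia.
have : 1 <= (k - n./2)%:R :> R by rewrite ler1n; lia.
suff : (k - n./2)%:R * 2 <= n%:R + 1 :> R by lra.
by rewrite -natrM natr1 ler_nat; lia.
Qed.

Lemma rep_cell t : 0 <= t <= n%:R / 2 -> exists2 k, (k <= n)%N & cell (rep k) = cell t.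
Proof.
move=> /andP[t0 tn]; have /andP[] := truncn_itv t0; set j := Num.trunc t.
rewrite le_eqVlt => /orP[/eqP jt _|jt tj].
  have : (j.*2 <= n)%N by rewrite -(ler_nat R) -muln2 natrM; lra.
  move=> jn; exists j; first by lia.
  by rewrite /rep -jt ifT //; lia.
have : (j.*2 < n)%N by rewrite -(ltr_nat R) -muln2 natrM; lra.
(* The midpoint [j + 1/2] is listed after the [n./2 + 1] integers; [2j < n] keeps its index at most
   [n]. *)
move=> jn; exists (j + n./2).+1; first by lia.
rewrite /rep ifF; last by lia.
have -> : ((j + n./2).+1 - n./2 = j.+1)%N by lia.
by rewrite !(@cell_open j) ?jt //; rewrite -natr1; lra.
Qed.

Definition sublevel k : set R :=
  [set t | (exists2 j, (j <= k)%N & t = j%:R)] `|` [set t | t <= (k - n./2)%:R].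

Lemma closed_sublevel k : closed (sublevel k).
Proof.
apply: closedU; last exact: closed_le.
have acc : accessible_space R by exact/hausdorff_accessible/Rhausdorff.
apply: (accessible_finite_set_closed.1 acc).
have -> : [set t | exists2 j, (j <= k)%N & t = j%:R] =
    (fun j : nat => j%:R : R) @` `I_k.+1.
  by apply/seteqP; split=> t [j jk jt]; exists j.
exact/finite_image/finite_II.
Qed.

Lemma sublevel_cell k s t : cell s = cell t -> sublevel k s -> sublevel k t.
Proof.
move=> st [[j jk /eqP sj]|sk].
  by left; exists j => //; apply/eqP; rewrite -(cell_eq j st).
by right; rewrite /= -(cell_le _ st).
Qed.

Lemma sublevel_le k : sublevel k `<=` sublevel k.+1.
Proof.
move=> t [[j jk ->]|tk]; first by left; exists j => //; exact: leqW.
by right; apply: le_trans tk _; rewrite ler_nat; lia.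
Qed.

Lemma sublevel_rep k : sublevel k (rep k).
Proof.
rewrite /rep; case: leqP => k2; first by left; exists k.
by right; rewrite /= lerBlDr lerDl.
Qed.

(** This makes the chain strict: the new representative is the integer [k + 1], or the half-integer
    [(k - n./2) + 1/2] just beyond the end of the half-line. *)
Lemma sublevel_repS k : ~ sublevel k (rep k.+1).
Proof.
rewrite /rep; case: (leqP k.+1 n./2) => k2 [[j jk]|] /=.
- by move/eqP; rewrite eqr_nat; lia.
- by rewrite ler_nat; lia.
- have -> : (k.+1 - n./2 = (k - n./2).+1)%N by lia.
  rewrite -natr1 => jE; have [jk'|jk'] := leqP j (k - n./2).
    have : j%:R <= (k - n./2)%:R :> R by rewrite ler_nat.
    lra.
  have : (k - n./2).+1%:R <= j%:R :> R by rewrite ler_nat.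
  by rewrite -natr1; lra.
- have -> : (k.+1 - n./2 = (k - n./2).+1)%N by lia.
  by rewrite -natr1; lra.
Qed.

(** The half-line in [sublevel n] ends at [n - n./2], which is [n/2] rounded up. *)
Lemma sublevel_full t : t <= n%:R / 2 -> sublevel n t.
Proof.
move=> tn; right; apply: le_trans tn _.
by rewrite ler_pdivrMr // -natrM ler_nat; lia.
Qed.

Lemma fold_bounds (x : I) : 0 <= fold (val x) <= n%:R / 2.
Proof.
have n0 := n0R; have /andP[x0 x1] := segment_bounds x.
rewrite /fold mulr_ge0 ?ler0n ?le_min ?subr_ge0 ?x0 //= ler_pM2l //.
by rewrite ge_min; have [//|/= ?] := leP (val x) 2^-1; lra.
Qed.

Lemma fold_surj t : 0 <= t <= n%:R / 2 -> exists x : I, fold (val x) = t.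
Proof.
have n0 := n0R; move=> /andP[t0 tn].
have tn2 : t / n%:R <= 2^-1 by rewrite ler_pdivrMr // mulrC.
have t01 : 0 <= t / n%:R <= 1 by rewrite divr_ge0 ?ler0n //= (le_trans tn2) //; lra.
exists (segment_point t01); rewrite fold_half //= mulrC divfK //.
by rewrite gt_eqF.
Qed.

Lemma height_levelG : height R levelG = (n%:R)%:E.
Proof.
have /choice[p pE] (k : 'I_n.+1) : exists x : I, fold (val x) = rep k.
  by apply/fold_surj/rep_bounds; rewrite -ltnS.
apply: height_max => [|m]; last first.
  (* Upper bound: each cell met by [fold] contains some [rep k], and cells pull back to single
     orbits. *)
  apply: (chain_le levelG_group (p := p)) => x.
  have [k kn kx] := rep_cell (fold_bounds x).
  by exists (Ordinal (kn : (k < n.+1)%N)); apply: levelG_transitive; rewrite pE.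
(* Lower bound: the preimages of the sublevels form a chain, and [p] at [k + 1] is new at each
   step. *)
exists (fun k => [set x : I | sublevel k (fold (val x))]); split.
- move=> k kn; split.
    exact: (closed_segment continuous_fold (@closed_sublevel k)).
  split=> [|g x [_ gE]]; last exact: sublevel_cell.
  exists (p (Ordinal (kn : (k < n.+1)%N))).
  by rewrite /= pE; exact: sublevel_rep.
- move=> k kn; split; first by move=> x; exact: sublevel_le.
  apply/eqP => /seteqP[_ /(_ (p (Ordinal (kn : (k.+1 < n.+1)%N))))].
  rewrite /= pE => /(_ (sublevel_rep _)); exact: sublevel_repS.
- apply/seteqP; split=> // x _; apply: sublevel_full.
  by have /andP[] := fold_bounds x.
Qed.

End Levels.

(** * The set of heights of the unit interval *)

Theorem theorem2p3 (R : realType) :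
  P_h R (set_type (`[0, 1]%classic : set R)) =
  [set ((n%:R)%:E : \bar R) | n in [set n : nat | (1 <= n)%N]] `|` [set +oo%E].
Proof.
apply/seteqP; split=> [_ [G Ggroup <-]|_ [[n n1 <-]|->]].
- by have [[n]|] := height_values R (has_chain1 Ggroup); [left; exists n | right].
- by exists (@levelG R n); [exact: levelG_group | exact: height_levelG].
- exists [set idfun]; first exact: homeo_subgroup1.
  apply: height_unbounded => n; exists n.+1; [exact: has_chain_id | exact: leqnSn].
Qed.
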